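(* For $n\geq 0$, $$F_{n+2}^I(x,y,q)=x^{n+2}q^{\binom{n+2}{2}}+\sum_{j=0}^{n}x^{n-j}y\,q^{\frac{n^2+3n-j^2+j}{2}}F_j^I(x,y,q).$$
   Context: $S_n(123,132,213)$ is the set of permutations of $[n]$ with no subsequence order isomorphic to $123$, $132$ or $213$; each such $\pi$ is a concatenation of increasing blocks of size $1$ or $2$, each block larger than all later blocks. $s(\pi)$, $d(\pi)$ are the numbers of maximal increasing runs of $\pi$ of length $1$ and $2$, and $inv(\pi)$ is the number of inversions. $F_n^I(x,y,q)=\sum_{\pi\in S_n(123,132,213)}x^{s(\pi)}y^{d(\pi)}q^{inv(\pi)}$ (so $F_0^I=1$). *)

(* Defs.v *)
From mathcomp Require Import all_boot all_order all_algebra all_fingroup.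
Set Implicit Arguments.
Unset Strict Implicit.
Unset Printing Implicit Defensive.
Import GRing.Theory.

(* Permutations of [n] are elements of 'S_n, i.e. both positions and values    *)
(* are shifted from {1, .., n} to {0, .., n-1}; a pattern is written as the    *)
(* word of its values, and only the relative order of the letters matters.     *)
Definition contains (n : nat) (pi : 'S_n) (tau : seq nat) : bool :=
  [exists f : {ffun 'I_(size tau) -> 'I_n},
     [forall i : 'I_(size tau), forall j : 'I_(size tau),
        ((i < j) ==> (f i < f j))
        && ((pi (f i) < pi (f j)) == (nth 0 tau i < nth 0 tau j))]].

Definition avoiders (n : nat) (pats : seq (seq nat)) : {set 'S_n} :=
  [set pi : 'S_n | all (fun tau => ~~ contains pi tau) pats].

Definition word (n : nat) (pi : 'S_n) : seq nat :=
  [seq val (pi i) | i <- enum 'I_n].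

(* w_i ... w_(i+l-1) is an increasing factor of w which can be extended        *)
(* neither to the left nor to the right.                                       *)
Definition max_inc_run (w : seq nat) (i l : nat) : bool :=
  [&& 0 < l, i + l <= size w, sorted ltn (take l (drop i w)),
      (i == 0) || ~~ (nth 0 w i.-1 < nth 0 w i)
    & (i + l == size w) || ~~ (nth 0 w (i + l).-1 < nth 0 w (i + l))].

Definition nruns (n : nat) (l : nat) (pi : 'S_n) : nat :=
  #|[set i : 'I_n | max_inc_run (word pi) i l]|.

Definition s (n : nat) (pi : 'S_n) : nat := nruns 1 pi.
Definition d (n : nat) (pi : 'S_n) : nat := nruns 2 pi.

Definition inv (n : nat) (pi : 'S_n) : nat :=
  #|[set p : 'I_n * 'I_n | (p.1 < p.2) && (pi p.2 < pi p.1)]|.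

(* The polynomial F_n^I evaluated in a commutative ring; the indeterminates    *)
(* of a polynomial ring are a special case.                                    *)
Definition FI (R : comNzRingType) (n : nat) (x y q : R) : R :=
  (\sum_(pi in avoiders n [:: [:: 1; 2; 3]; [:: 1; 3; 2]; [:: 2; 1; 3]]%N)
     x ^+ s pi * y ^+ d pi * q ^+ inv pi)%R.

(* Main.v *)
(** A permutation avoids 123, 132 and 213 exactly when every letter exceeds all
    the letters at distance at least 2 to its right.  Hence an avoider of size
    m+2 starts either with the largest letter m+1, or with m, m+1; deleting this
    first block gives
      F_(m+2) = x q^(m+1) F_(m+1) + y q^(2m) F_m,
    and unfolding the first summand down to F_1 gives the theorem. *)
Require Import Defs.
From mathcomp Require Import all_boot all_order all_algebra all_fingroup.
From mathcomp Require Import zify ring.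
Import GRing.Theory.

(** * Far-decreasing words and their block structure *)

Definition far_decreasing (w : seq nat) : Prop :=
  forall i k, i.+1 < k < size w -> nth 0 w k < nth 0 w i.

(** The words of the avoiders, generated by the choice of the first block. A list makes sums split
    along [++] according to that choice. *)
Fixpoint block_words (n : nat) : seq (seq nat) :=
  match n with
  | 0 => [:: [::]]
  | 1 => [:: [:: 0]]
  | (k.+1 as m).+1 => [seq m :: w | w <- block_words m]
                      ++ [seq [:: k, m & w] | w <- block_words k]
  end.

(** The statistics are moved to words because deleting a block is immediate there, whereas in ['S_n]
    it changes the type. *)
Definition word_nruns (l : nat) (w : seq nat) : nat :=
  count (fun i => max_inc_run w i l) (iota 0 (size w)).

Fixpoint word_inv (w : seq nat) : nat :=
  if w is a :: w' then count (gtn a) w' + word_inv w' else 0.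

Lemma block_wordsSS n : block_words n.+2 =
  [seq n.+1 :: w | w <- block_words n.+1]
  ++ [seq [:: n, n.+1 & w] | w <- block_words n].
Proof. by []. Qed.

Lemma nat_ind2 (P : nat -> Prop) :
  P 0 -> P 1 -> (forall n, P n -> P n.+1 -> P n.+2) -> forall n, P n.
Proof.
move=> P0 P1 PSS n; suff [] : P n /\ P n.+1 by [].
by elim: n => [|n [IH1 IH2]]; split => //; apply: PSS.
Qed.

Lemma far_decreasing_cons a w :
  far_decreasing (a :: w) <-> (all (gtn a) (behead w) /\ far_decreasing w).
Proof.
split=> [H|[/allP H1 H2] [|i] [|k] //= /andP[ik ks]]; last first.
- by apply: H2; rewrite -ltnS ik.
- apply: H1; case: w {H2} ks ik => [|b w] //=; case: k => [|k] //= ks _.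
  by apply: mem_nth; rewrite -ltnS.
split; last by move=> i k ik; apply: (H i.+1 k.+1).
apply/allP => z; case: w H => [|b w] H //= /(nthP 0)[k kw <-].
exact: (H 0 k.+2).
Qed.

Lemma perm_iotaS_cons n w :
  perm_eq (n :: w) (iota 0 n.+1) = perm_eq w (iota 0 n).
Proof.
rewrite -addn1 iotaD add0n /= -[RHS](perm_cons n).
by have /permPr-> := permEl (perm_catC (iota 0 n) [:: n]).
Qed.

Lemma perm_iota_all_ltn n w : perm_eq w (iota 0 n) -> all (gtn n) w.
Proof.
by move=> /perm_mem E; apply/allP => z; rewrite E mem_iota add0n => /andP[].
Qed.

Lemma all_gtnW a b w : a <= b -> all (gtn a) w -> all (gtn b) w.
Proof. by move=> ab; apply: sub_all => z /= /leq_trans; apply. Qed.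

Lemma all_behead (T : Type) (a : pred T) w : all a w -> all a (behead w).
Proof. by case: w => //= b w /andP[]. Qed.

(** Conversely to the construction, letters from the third position on are smaller than the first
    letter [a]. So [n.+1] is the first or the second letter. If it is the second, then [n] must be
    [a]: further right it would force [a = n.+1]. *)
Lemma block_wordsP n w :
  reflect (perm_eq w (iota 0 n) /\ far_decreasing w) (w \in block_words n).
Proof.
apply: (iffP idP); elim/nat_ind2: n w => [|| n IH0 IH1] w.
- by rewrite inE => /eqP->; split=> // i k /andP[].
- by rewrite inE => /eqP->; split=> // i [|k] /andP[].
- rewrite block_wordsSS mem_cat => /orP[] /mapP[v].
    move=> /IH1[pv fv] ->; rewrite perm_iotaS_cons; split=> //.
    by apply/far_decreasing_cons; split=> //; exact/all_behead/perm_iota_all_ltn.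
  move=> /IH0[pv fv] ->.
  (* Swapping the first two letters puts [n.+1] in front, so that the largest letter can be stripped
     twice. *)
  rewrite (permPl (permEl (perm_catCA [:: n] [:: n.+1] v))) !perm_iotaS_cons.
  split=> //; have av := perm_iota_all_ltn _ _ pv.
  apply/far_decreasing_cons; split=> //; apply/far_decreasing_cons; split=> //.
  exact/all_behead/(all_gtnW _ _ _ (leqnSn n)).
- by case=> /perm_nilP ->.
- by case=> /perm_small_eq->.
- rewrite block_wordsSS mem_cat => -[pw fw].
  have sw := perm_size pw; rewrite size_iota in sw.
  case: w sw pw fw => [|a [|b w]] // [sw] pw fw.
  have /far_decreasing_cons[/= aw fbw] := fw.
  have /far_decreasing_cons[_ fw'] := fbw.
  have mw z : (z \in [:: a, b & w]) = (z < n.+2).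
    by rewrite (perm_mem pw) mem_iota.
  have [an|an] := eqVneq a n.+1.
    by rewrite an perm_iotaS_cons in pw; rewrite an map_f //; apply: IH1.
  have bn : b = n.+1.
    apply/eqP; have := mw n.+1; rewrite ltnSn !inE eq_sym (negPf an) /=.
    rewrite eq_sym; case/orP => // /(allP aw) /=.
    by have := mw a; rewrite inE eqxx /=; lia.
  have {}an : a = n.
    have : n \in [:: a, b & w] by rewrite mw.
    rewrite !inE bn (ltn_eqF (ltnSn n)) /= => /orP[/eqP//|/(allP aw) /=].
    by have := mw a; rewrite inE eqxx /=; lia.
  rewrite an bn in pw *; apply/orP; right; apply: map_f; apply: IH0.
  split=> //; move: pw.
  by rewrite (permPl (permEl (perm_catCA [:: n] [:: n.+1] w))) !perm_iotaS_cons.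
Qed.

(** The two families are disjoint because their first letters are [n.+1] and [n]. *)
Lemma uniq_block_words n : uniq (block_words n).
Proof.
elim/nat_ind2: n => // n IH0 IH1; rewrite block_wordsSS cat_uniq.
rewrite !map_inj_uniq ?IH0 ?IH1 ?andbT; try by move=> u v [].
apply/hasPn => _ /mapP[w _ ->]; apply/mapP => -[v _ [E _]].
by move: E; lia.
Qed.

(** * Permutations as words, and pattern avoidance *)

Lemma size_word n (pi : 'S_n) : size (word pi) = n.
Proof. by rewrite size_map size_enum_ord. Qed.

Lemma nth_word n (pi : 'S_n) (i : 'I_n) : nth 0 (word pi) i = pi i.
Proof. by rewrite (nth_map i) ?size_enum_ord // nth_ord_enum. Qed.

Lemma word_inj n : injective (@word n).
Proof.
by move=> pi rho E; apply/permP => i; apply: val_inj; rewrite /= -!nth_word E.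
Qed.

Lemma perm_word n (pi : 'S_n) : perm_eq (word pi) (iota 0 n).
Proof.
rewrite -val_enum_ord /word -[X in perm_eq X _]/(map _ _) map_comp.
apply: perm_map; apply: uniq_perm; rewrite ?enum_uniq //.
  by rewrite map_inj_uniq ?enum_uniq //; exact: perm_inj.
move=> i; rewrite mem_enum inE; apply/mapP; exists ((pi^-1)%g i).
  by rewrite mem_enum.
by rewrite permKV.
Qed.

Lemma word_surj n w : perm_eq w (iota 0 n) -> exists pi : 'S_n, word pi = w.
Proof.
move=> pw; have sw : size w = n by rewrite (perm_size pw) size_iota.
have uw : uniq w by rewrite (perm_uniq pw) iota_uniq.
have wn (i : 'I_n) : nth 0 w i < n.
  have : nth 0 w i \in w by rewrite mem_nth ?sw.
  by rewrite (perm_mem pw) mem_iota.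
pose f (i : 'I_n) := Ordinal (wn i).
have finj : injective f.
  move=> i j /(congr1 val) /= /eqP; rewrite nth_uniq ?sw // => /eqP.
  exact: val_inj.
exists (perm finj); apply: (@eq_from_nth _ 0); rewrite size_word // => i ni.
by rewrite (nth_word _ (perm finj) (Ordinal ni)) permE.
Qed.

(** [contains] compares all ordered pairs of positions, hence six comparisons; the diagonal ones are
    trivial. *)
Lemma contains3 n (pi : 'S_n) a b c (i j k : 'I_n) :
  i < j < k ->
  [&& (pi i < pi j) == (a < b), (pi i < pi k) == (a < c)
    & (pi j < pi k) == (b < c)] ->
  [&& (pi j < pi i) == (b < a), (pi k < pi i) == (c < a) & (pi k < pi j) == (c < b)] ->
  contains pi [:: a; b; c].
Proof.
move=> /andP[ij jk] /and3P[h1 h2 h3] /and3P[h4 h5 h6].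
apply/existsP; exists [ffun t : 'I_3 => nth i [:: i; j; k] t].
apply/forallP => t; apply/forallP => u; rewrite !ffunE.
have ik := ltn_trans ij jk.
by case: t => [[|[|[|]]]] //= _; case: u => [[|[|[|]]]] //= _;
  rewrite ?ltnn ?ij ?jk ?ik ?(eqP h1) ?(eqP h2) ?(eqP h3) ?(eqP h4) ?(eqP h5)
          ?(eqP h6) ?eqxx //.
Qed.

(** The middle letter of the occurrence separates the outer two. In 123, 132 and 213 the first
    letter is below the last, so each occurrence violates [far_decreasing]. *)
Lemma contains3_far n (pi : 'S_n) a b c :
  contains pi [:: a; b; c] ->
  exists i k : 'I_n, i.+1 < k /\ (pi i < pi k) = (a < c).
Proof.
case/existsP => f /forallP H.
pose o t (h : t < 3) : 'I_3 := Ordinal h.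
exists (f (o 0 isT)), (f (o 2 isT)).
have /forallP/(_ (o 1 isT))/andP[h01 _] := H (o 0 isT).
have /forallP/(_ (o 2 isT))/andP[h12 _] := H (o 1 isT).
have /forallP/(_ (o 2 isT))/andP[_ /eqP h] := H (o 0 isT).
by split; [exact: leq_ltn_trans h01 h12 | exact: h].
Qed.

Lemma avoiders_far_decreasing n (pi : 'S_n) :
  reflect (far_decreasing (word pi))
    (pi \in avoiders n [:: [:: 1; 2; 3]; [:: 1; 3; 2]; [:: 2; 1; 3]]).
Proof.
rewrite inE /= andbT; apply: (iffP and3P) => [[a b c] i k|H].
  rewrite size_word => /andP[ik kn].
  have jn := ltn_trans ik kn; have iN := ltn_trans (ltnSn i) jn.
  pose i' := Ordinal iN; pose j' := Ordinal jn; pose k' := Ordinal kn.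
  rewrite (nth_word _ pi k') (nth_word _ pi i').
  have ijk : i' < j' < k' by rewrite /= ltnSn.
  have d1 : (pi i' : nat) != pi j'.
    by rewrite (inj_eq val_inj) (inj_eq perm_inj) -(inj_eq val_inj) /=; lia.
  have d2 : (pi j' : nat) != pi k'.
    by rewrite (inj_eq val_inj) (inj_eq perm_inj) -(inj_eq val_inj) /=; lia.
  have d3 : (pi i' : nat) != pi k'.
    by rewrite (inj_eq val_inj) (inj_eq perm_inj) -(inj_eq val_inj) /=; lia.
  rewrite ltnNge; apply/negP => le.
  have lt : pi i' < pi k' by rewrite ltn_neqAle d3.
  (* Given [pi i' < pi k'], the value at the intermediate position [j'] lies below, between or above
     these two, giving 213, 123 or 132. *)
  have [l1|l1] := boolP (pi i' < pi j'); last first.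
    by case/negP: c; apply: (contains3 n pi 2 1 3 _ _ _ ijk) => /=; lia.
  have [l2|l2] := boolP (pi j' < pi k').
    by case/negP: a; apply: (contains3 n pi 1 2 3 _ _ _ ijk) => /=; lia.
  by case/negP: b; apply: (contains3 n pi 1 3 2 _ _ _ ijk) => /=; lia.
by split; apply/negP => /contains3_far[i [k [ik E]]];
  have := H i k; rewrite size_word ik ltn_ord !nth_word => /(_ isT);
  move: E => /=; lia.
Qed.

(** * Runs and inversions computed on words *)

Lemma nruns_word n l (pi : 'S_n) : nruns l pi = word_nruns l (word pi).
Proof.
rewrite /nruns /word_nruns size_word -val_enum_ord count_map cardE -size_filter.
by congr size; rewrite enumT /enum_mem; apply: eq_filter => i; rewrite /= inE.
Qed.

Lemma word_invE w : word_inv w =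
  \sum_(i < size w) \sum_(j < size w) ((i < j) && (nth 0 w j < nth 0 w i)).
Proof.
elim: w => [|a w IH]; first by rewrite big_ord0.
rewrite /= big_ord_recl /= big_ord_recl /= add0n; congr (_ + _).
  by rewrite -sum1_count (big_nth 0) big_mkord big_mkcond.
by rewrite IH; apply: eq_bigr => i _; rewrite big_ord_recl.
Qed.

Lemma inv_word n (pi : 'S_n) : Defs.inv pi = word_inv (word pi).
Proof.
rewrite word_invE size_word /Defs.inv -sum1_card big_mkcond /=.
rewrite (pair_bigA _ (fun i j : 'I_n =>
  nat_of_bool ((i < j) && (nth 0 (word pi) j < nth 0 (word pi) i)))) /=.
by apply: eq_bigr => p _; rewrite inE !nth_word.
Qed.

(** Only the left end of a run at [i = 0] is affected: it is no longer the start of the word, but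
    the descent from [a] still blocks an extension. *)
Lemma max_inc_run_cons a w i l : all (gtn a) w ->
  max_inc_run (a :: w) i.+1 l = max_inc_run w i l.
Proof.
move=> aw; rewrite /max_inc_run /= addSn ltnS eqSS.
case: l => [|l] //=; rewrite !addnS /=.
case: i => [|i] //=; congr [&& _, _ & _].
case: w aw => [|b w] //= /andP[ba _].
by rewrite -leqNgt (ltnW ba).
Qed.

(** The descent after [a] makes it a run of length exactly 1. *)
Lemma word_nruns_cons a w l : all (gtn a) w ->
  word_nruns l (a :: w) = (l == 1) + word_nruns l w.
Proof.
move=> aw; rewrite /word_nruns /= (iotaDl 1 0) count_map.
congr (_ + _); last by apply: eq_count => i /=; rewrite max_inc_run_cons.
congr nat_of_bool; rewrite /max_inc_run drop0.
case: l => [|[|l]] //=; case: w aw => [|b w] //= /andP[ba _].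
  by rewrite -leqNgt (ltnW ba).
by rewrite ltnNge (ltnW ba) /= andbF.
Qed.

Lemma word_nruns_cons2 a b w l : a < b -> all (gtn b) w ->
  word_nruns l [:: a, b & w] = (l == 2) + word_nruns l w.
Proof.
move=> ab bw; rewrite /word_nruns /= (iotaDl 2 0) count_map addnA.
congr (_ + _); last first.
  (* A run starting at position 2 or later looks back no further than [b], so [a] disappears by
     computation. *)
  by apply: eq_count => i /=; rewrite add2n -(max_inc_run_cons b w) //.
(* No maximal run starts at [b], since [a < b] extends it to the left. *)
rewrite /max_inc_run /= ab /= !andbF addn0.
congr nat_of_bool.
case: l => [|[|[|l]]] //=; rewrite ?ab //=; case: w bw => [|c w] //= /andP[cb _].
  by rewrite -leqNgt (ltnW cb).
by rewrite ltnNge (ltnW cb) /= andbF.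
Qed.

(** * The recurrence for the polynomials and its unfolding *)

Local Open Scope ring_scope.

Definition word_weight (R : comNzRingType) (x y q : R) (w : seq nat) : R :=
  x ^+ word_nruns 1 w * y ^+ word_nruns 2 w * q ^+ word_inv w.

Lemma FI_block_words (R : comNzRingType) n (x y q : R) :
  FI n x y q = \sum_(w <- block_words n) word_weight R x y q w.
Proof.
rewrite /FI -big_enum /=.
under eq_bigr => pi _ do rewrite /s /d !nruns_word inv_word.
rewrite -(big_map (@word n) xpredT (word_weight R x y q)).
apply: perm_big; apply: uniq_perm; rewrite ?uniq_block_words //.
  by rewrite map_inj_uniq ?enum_uniq //; exact: word_inj.
move=> w; apply/mapP/block_wordsP => [[pi]|[pw fw]].
  rewrite mem_enum => /avoiders_far_decreasing fpi ->.
  by split=> //; exact: perm_word.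
have [pi E] := word_surj n w pw; exists pi => //.
by rewrite mem_enum; apply/avoiders_far_decreasing; rewrite E.
Qed.

Lemma FI0 (R : comNzRingType) (x y q : R) : FI 0 x y q = 1.
Proof. by rewrite FI_block_words big_seq1 /word_weight !expr0 !mulr1. Qed.

Lemma FI1 (R : comNzRingType) (x y q : R) : FI 1 x y q = x.
Proof. by rewrite FI_block_words big_seq1 /word_weight !expr0 !mulr1 expr1. Qed.

(** A leading [n.+1] is inverted with all [n.+1] later letters. In a leading block [n], [n.+1] each
    letter is inverted with the [n] letters after the block, and the block itself has no
    inversion. *)
Lemma FI_rec (R : comNzRingType) n (x y q : R) :
  FI n.+2 x y q =
    x * q ^+ n.+1 * FI n.+1 x y q + y * q ^+ (n + n) * FI n x y q.
Proof.
rewrite !FI_block_words block_wordsSS big_cat !big_map !mulr_sumr.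
congr (_ + _); rewrite !big_seq; apply: eq_bigr => w /block_wordsP[pw _];
  have aw := perm_iota_all_ltn _ _ pw; have := perm_size pw;
  rewrite size_iota /word_weight => sw.
  rewrite !word_nruns_cons //= (eqP (eq_trans (esym (all_count _ _)) aw)) sw.
  by rewrite add0n add1n exprS exprD; ring.
have aw' := all_gtnW _ _ _ (leqnSn n) aw.
rewrite !word_nruns_cons2 //= ltnNge leqnSn /=.
rewrite (eqP (eq_trans (esym (all_count _ _)) aw)).
rewrite (eqP (eq_trans (esym (all_count _ _)) aw')) sw.
by rewrite !add0n add1n exprS !exprD; ring.
Qed.

Theorem theorem4p4 (R : comNzRingType) (x y q : R) (n : nat) :
  FI n.+2 x y q =
    x ^+ n.+2 * q ^+ 'C(n.+2, 2)
    + \sum_(0 <= j < n.+1)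
        x ^+ (n - j) * y * q ^+ ((n ^ 2 + 3 * n - j ^ 2 + j) %/ 2) * FI j x y q.
Proof.
elim: n => [|n IH].
  by rewrite FI_rec big_nat1 FI1 FI0 /=; rewrite !expr0; ring.
(* The factor [x * q ^+ n.+2] turns the old terms into the new ones with [j <= n]; the second
   summand of the recurrence is the new term [j = n.+1]. *)
rewrite FI_rec IH [in RHS]big_nat_recr //= mulrDr -addrA; congr (_ + _).
  by rewrite [in RHS]binS bin1 exprD [in RHS]exprS; ring.
rewrite mulr_sumr; congr (_ + _).
  apply: eq_big_nat => j /andP[_ jn].
  (* The numerator grows by [2 * n.+2]; the truncated subtraction is exact because [j <= n]. *)
  have -> : ((n.+1 ^ 2 + 3 * n.+1 - j ^ 2 + j) %/ 2 =
             n.+2 + (n ^ 2 + 3 * n - j ^ 2 + j) %/ 2)%N.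
    rewrite -divnMDl //; congr (_ %/ 2)%N; nia.
  by rewrite subSn // exprD [in RHS]exprS; ring.
rewrite subnn expr0 mul1r; congr (_ * q ^+ _ * _).
have -> : (n.+1 ^ 2 + 3 * n.+1 - n.+1 ^ 2 + n.+1 = (n.+1 + n.+1) * 2)%N by lia.
by rewrite mulnK.
Qed.
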